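(* Let $f=\sum_{i=1}^n f_i$ (in the block sense $f(y)=\sum_{i=1}^n f_i(y_i)$, $y=(y_1,\dots,y_n)$), $g$ and $h$ be proper convex lower-semicontinuous functions, where $h:\mathbb{R}^d\to\mathbb{R}$ is differentiable with $L$-Lipschitz continuous gradient. Let $(x^\star,y^\star)$ be a saddle point of $\Phi$, and let $(x^k,y^k)_{k\ge 0}$ be the iterates generated by the algorithm TOS-SPDHG with $\theta=1$, initialized at $x^0\in\mathbb{R}^d$ and $y^0\in\mathbb{R}^q$, with fixed symmetric positive definite step-size matrices $T_k=T\in\mathbb{R}^{d\times d}$ and $S_k=S=\mathrm{diag}(S^1,\dots,S^n)$ for all $k$. Suppose that $T^{-1}-LI$ is positive definite and that there exist ESO parameters $\{v_i\}_{i=1}^n$ of $S^{1/2}A(T^{-1}-LI)^{-1/2}$ with $v_i<p_i$ for all $i\in\{1,\dots,n\}$. Define the ergodic averages $$x_{(K)}=\frac1K\sum_{k=1}^K x^k,\qquad y_{(K)}=\frac1K\sum_{k=1}^K y^k .$$ Then $$\mathbb{E}\left(\Phi(x_{(K)},y^\star)-\Phi(x^\star,y_{(K)})\right)\le O\left(\frac1K\right).$$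
   Context: **Problem.** Let $X\subseteq\mathbb{R}^d$ be a nonempty closed convex set (the constraint set), $A_i\in\mathbb{R}^{m\times d}$ for $i=1,\dots,n$, and $A$ the stacked linear operator $(Ax)_i=A_ix$, with values in $\mathbb{R}^q$, $q=nm$. The functions $f_i:\mathbb{R}^m\to\mathbb{R}\cup\{+\infty\}$ and $g:\mathbb{R}^d\to\mathbb{R}\cup\{+\infty\}$ are proper, convex and lower-semicontinuous, and $g$ is finite at some point of $X$. The convex conjugate is $f_i^*(y_i)=\sup_{z\in\mathbb{R}^m}\langle z,y_i\rangle-f_i(z)$, and $f^*(y)=\sum_{i=1}^n f_i^*(y_i)$. The saddle function is $$\Phi(x,y)=h(x)+g(x)+\sum_{i=1}^n\left(\langle A_ix,y_i\rangle-f_i^*(y_i)\right),$$ and a saddle point is a solution $(x^\star,y^\star)$ of $\min_{x\in X}\max_{y\in\mathbb{R}^q}\Phi(x,y)$, that is, $\Phi(x^\star,y)\le\Phi(x^\star,y^\star)\le\Phi(x,y^\star)$ for all $x\in X$, $y\in\mathbb{R}^q$, with $\Phi(x^\star,y^\star)$ finite. **Proximal operators.** For a symmetric positive definite matrix $T$, $$\mathrm{prox}_g^T(x)=\arg\min_{z\in X}\tfrac12\langle T^{-1}(z-x),z-x\rangle+g(z),$$ and, for symmetric positive definite $S^i\in\mathbb{R}^{m\times m}$, $\mathrm{prox}_{f_i^*}^{S^i}(y_i)=\arg\min_{z\in\mathbb{R}^m}\tfrac12\langle (S^i)^{-1}(z-y_i),z-y_i\rangle+f_i^*(z)$. **Sampling.**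 At each iteration $k$ a random subset $\mathbb{S}_k\subseteq\{1,\dots,n\}$ is drawn, independently and identically distributed over $k$ with the law of a random set $\mathbb{S}$, with $p_i=\mathbb{P}(i\in\mathbb{S})>0$ for every $i$ (serial sampling, $\mathbb{S}_k=\{j_k\}$ for a single random index $j_k$, is a special case). Set $Q=\mathrm{diag}(p_1^{-1}I,\dots,p_n^{-1}I)$. **Algorithm TOS-SPDHG.** Given $x^0\in\mathbb{R}^d$, $y^0\in\mathbb{R}^q$, $\bar y^0=y^0$, for $k=0,1,2,\dots$: - draw $\mathbb{S}_k$; - $x^{k+1}=\mathrm{prox}_g^{T_k}\left(x^k-T_k(A^T\bar y^k+\nabla h(x^k))\right)$; - $y_i^{k+1}=\mathrm{prox}_{f_i^*}^{S_k^i}(y_i^k+S_k^iA_ix^{k+1})$ if $i\in\mathbb{S}_k$, and $y_i^{k+1}=y_i^k$ otherwise; - $\bar y^{k+1}=y^{k+1}+\theta Q(y^{k+1}-y^k)$. Here $S_k=\mathrm{diag}(S_k^1,\dots,S_k^n)$. **ESO (expected separable overapproximation) parameters.** For a linear operator $C$ with blocks $(Cx)_i=C_ix$, real numbers $\{v_i\}_{i=1}^n$ are ESO parameters of $C$ (for the sampling $\mathbb{S}$) if for all $z=(z_1,\dots,z_n)$ $$\mathbb{E}_{\mathbb{S}}\left\|\sum_{i\in\mathbb{S}}C_i^Tz_i\right\|_2^2\le\sum_{i=1}^np_iv_i\|z_i\|_2^2 .$$ For $C=S^{1/2}A(T^{-1}-LI)^{-1/2}$ the blocks are $C_i=(S^i)^{1/2}A_i(T^{-1}-LI)^{-1/2}$.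 The expectation $\mathbb{E}$ is over all the random sets $\mathbb{S}_k$, and $O(1/K)$ refers to the dependence on the number of iterations $K$.
   Formalization: The formal theorem also assumes that f_i^*(y_i^0) is finite for every i with p_i < 1; otherwise block i is never updated in K steps with positive probability, and the expected gap is +∞ for every K. *)

(* Defs.v *)
(* Vectors of R^d are columns 'cV[R]_d; an element of R^q, with q = n * m, is
   given by its n blocks, y : 'I_n -> 'cV[R]_m. *)
From HB Require Import structures.
From mathcomp Require Export all_boot all_order all_algebra.
From mathcomp Require Export all_classical all_reals all_analysis.

Set Implicit Arguments.
Unset Strict Implicit.
Unset Printing Implicit Defensive.

Export Order.TTheory GRing.Theory Num.Theory.
Export numFieldNormedType.Exports.

Local Open Scope classical_set_scope.
Local Open Scope ring_scope.

(* The library norm on matrices is the sup norm, hence the explicit Euclidean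
   inner product and norm; the topologies coincide. *)
Definition dot (R : realType) (d : nat) (u v : 'cV[R]_d) : R :=
  \sum_i u i 0 * v i 0.

Definition norm2 (R : realType) (d : nat) (u : 'cV[R]_d) : R :=
  Num.sqrt (dot u u).

Definition spd (R : realType) (d : nat) (M : 'M[R]_d) : Prop :=
  M^T = M /\ forall u : 'cV[R]_d, u != 0 -> 0 < dot (M *m u) u.

(* B = M^{1/2}: the unique symmetric positive definite square root of M. *)
Definition is_sqrtmx (R : realType) (d : nat) (M B : 'M[R]_d) : Prop :=
  spd B /\ B *m B = M.

Definition eproper (R : realType) (d : nat) (f : 'cV[R]_d -> \bar R) : Prop :=
  (forall x, (-oo < f x)%E) /\ exists x, (f x < +oo)%E.

(* Used only for functions that never take the value -oo, so that the
   right-hand side is never of the form oo - oo. *)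
Definition econvex (R : realType) (d : nat) (f : 'cV[R]_d -> \bar R) : Prop :=
  forall (x y : 'cV[R]_d) (t : R), 0 < t < 1 ->
    (f (t *: x + (1 - t) *: y)%R <= t%:E * f x + (1 - t)%:E * f y)%E.

Definition conjugate (R : realType) (d : nat) (f : 'cV[R]_d -> \bar R)
    (y : 'cV[R]_d) : \bar R :=
  ereal_sup [set ((dot z y)%:E - f z)%E | z in setT].

Definition grad (R : realType) (d : nat) (h : 'cV[R]_d -> R) (x : 'cV[R]_d) :
    'cV[R]_d :=
  \col_i 'D_(delta_mx i 0) h x.

(* The set of minimizers over X; a singleton whenever T is symmetric positive
   definite, X is closed convex, and g is convex, lower semicontinuous, nowhere
   -oo and finite somewhere on X. *)
Definition prox (R : realType) (d : nat) (X : set 'cV[R]_d) (T : 'M[R]_d)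
    (g : 'cV[R]_d -> \bar R) (u : 'cV[R]_d) : set 'cV[R]_d :=
  let obj z := ((2^-1 * dot (invmx T *m (z - u)) (z - u))%:E + g z)%E in
  [set z | X z /\ forall z', X z' -> (obj z <= obj z')%E].

(* In \bar R, +oo + -oo = -oo.  That convention only matters when g x and some
   conjugate are both +oo, which does not occur in Phi x ystar, nor in
   Phi xstar y, if Phi xstar ystar is finite. *)
Definition Phi (R : realType) (d m n : nat) (A : 'I_n -> 'M[R]_(m, d))
    (f : 'I_n -> 'cV[R]_m -> \bar R) (g : 'cV[R]_d -> \bar R)
    (h : 'cV[R]_d -> R) (x : 'cV[R]_d) (y : 'I_n -> 'cV[R]_m) : \bar R :=
  ((h x)%:E + g x
   + \sum_(i < n) ((dot (A i *m x) (y i))%:E - conjugate (f i) (y i)))%E.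

Definition saddle_point (R : realType) (d m n : nat) (X : set 'cV[R]_d)
    (Psi : 'cV[R]_d -> ('I_n -> 'cV[R]_m) -> \bar R)
    (xs : 'cV[R]_d) (ys : 'I_n -> 'cV[R]_m) : Prop :=
  [/\ X xs,
      Psi xs ys \is a fin_num,
      forall y, (Psi xs y <= Psi xs ys)%E
    & forall x, X x -> (Psi xs ys <= Psi x ys)%E].

(* The law of a random subset of 'I_n is given by its probability mass
   function. *)
Definition inclusion_prob (R : realType) (n : nat) (law : {set 'I_n} -> R)
    (i : 'I_n) : R :=
  \sum_(J : {set 'I_n} | i \in J) law J.

Definition eso (R : realType) (d m n : nat) (law : {set 'I_n} -> R)
    (C : 'I_n -> 'M[R]_(m, d)) (v : 'I_n -> R) : Prop :=
  forall z : 'I_n -> 'cV[R]_m,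
    \sum_(J : {set 'I_n}) law J * norm2 (\sum_(i in J) (C i)^T *m z i) ^+ 2
    <= \sum_(i < n) inclusion_prob law i * v i * norm2 (z i) ^+ 2.

Definition iid_sampling (dd : measure_display) (Omega : measurableType dd)
    (R : realType) (P : probability Omega R) (n : nat)
    (law : {set 'I_n} -> R) (Sk : nat -> Omega -> {set 'I_n}) : Prop :=
  [/\ forall k J, measurable [set w | Sk k w = J],
      forall k J, P [set w | Sk k w = J] = (law J)%:E
    & forall (s : seq nat) (E : nat -> {set {set 'I_n}}), uniq s ->
        P [set w | forall k, k \in s -> Sk k w \in E k]
        = (\prod_(k <- s) P [set w | Sk k w \in E k])%E].

(* (x, y, ybar) is the run of TOS-SPDHG along the realized samples s. *)
Definition tos_spdhg (R : realType) (d m n : nat) (X : set 'cV[R]_d)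
    (A : 'I_n -> 'M[R]_(m, d)) (f : 'I_n -> 'cV[R]_m -> \bar R)
    (g : 'cV[R]_d -> \bar R) (h : 'cV[R]_d -> R)
    (p : 'I_n -> R) (theta : R)
    (T : nat -> 'M[R]_d) (S : nat -> 'I_n -> 'M[R]_m)
    (x0 : 'cV[R]_d) (y0 : 'I_n -> 'cV[R]_m) (s : nat -> {set 'I_n})
    (x : nat -> 'cV[R]_d) (y ybar : nat -> 'I_n -> 'cV[R]_m) : Prop :=
  [/\ x 0%N = x0, y 0%N = y0, ybar 0%N = y0
    & forall k,
      [/\ prox X (T k) g
            (x k - T k *m (\sum_(i < n) (A i)^T *m ybar k i + grad h (x k)))
            (x k.+1),
          forall i, i \in s k ->
            prox setT (S k i) (conjugate (f i))
              (y k i + S k i *m (A i *m x k.+1)) (y k.+1 i),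
          forall i, i \notin s k -> y k.+1 i = y k i
        & forall i, ybar k.+1 i
            = y k.+1 i + theta *: ((p i)^-1 *: (y k.+1 i - y k i))]].

Definition ergodic_avg (R : realType) (d : nat) (u : nat -> 'cV[R]_d)
    (K : nat) : 'cV[R]_d :=
  K%:R^-1 *: \sum_(1 <= k < K.+1) u k.

(* Main.v *)
Require Import Defs.
From mathcomp Require Import measurable_realfun ring lra.

(* Fix a saddle point (x*, y* ) and write D_i for the nonnegative excess of f_i^*
   over its linearization at y*_i with slope A_i x*.  The variational inequality of
   each prox, the descent lemma and convexity of h give, conditionally on the
   first k samples, a one-step inequality for the Lyapunov function
     |x - x*|^2_{T^-1} / 2 + sum_i |y_i - y*_i|^2_{S_i^-1} / (2 p_i)
       + sum_i (1 / p_i - 1) D_i(y_i) - <A (x - x* ), Q (y - y_prev)>.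
   Extrapolation makes the bilinear terms telescope up to
   <A (x_next - x), Q (y - y_prev)>; Young's inequality splits it into a term
   absorbed by |x_next - x|^2_{T^-1 - L} and the square of a sum over the sampled
   blocks, whose expectation the ESO inequality bounds by the dual decrease
   |y_hat - y_prev|^2_{S^-1} / 2 of the previous step.  Summing over the steps and
   applying Jensen's inequality to the averages gives the rate.

   By uniqueness of the prox the iterates depend only on the past samples, so
   every expectation is a finite sum over sample histories. *)

Set Implicit Arguments.
Unset Strict Implicit.
Unset Printing Implicit Defensive.

Local Open Scope classical_set_scope.
Local Open Scope ring_scope.

(** * Euclidean geometry and positive definite matrices *)

Section Dot.
Context {R : realType}.

Lemma dotC d (u v : 'cV[R]_d) : dot u v = dot v u.
Proof. by apply: eq_bigr => i _; rewrite mulrC. Qed.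

Lemma dotDl d (u v w : 'cV[R]_d) : dot (u + v) w = dot u w + dot v w.
Proof. by rewrite -big_split; apply: eq_bigr => i _; rewrite mxE mulrDl. Qed.

Lemma dotZl d a (u v : 'cV[R]_d) : dot (a *: u) v = a * dot u v.
Proof. by rewrite mulr_sumr; apply: eq_bigr => i _; rewrite mxE mulrA. Qed.

Lemma dotNl d (u v : 'cV[R]_d) : dot (- u) v = - dot u v.
Proof. by rewrite -scaleN1r dotZl mulN1r. Qed.

Lemma dotDr d (u v w : 'cV[R]_d) : dot u (v + w) = dot u v + dot u w.
Proof. by rewrite ![dot u _]dotC dotDl. Qed.

Lemma dotZr d a (u v : 'cV[R]_d) : dot u (a *: v) = a * dot u v.
Proof. by rewrite ![dot u _]dotC dotZl. Qed.

Lemma dotNr d (u v : 'cV[R]_d) : dot u (- v) = - dot u v.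
Proof. by rewrite ![dot u _]dotC dotNl. Qed.

Lemma dot0l d (u : 'cV[R]_d) : dot 0 u = 0.
Proof. by rewrite -(scale0r 0) dotZl mul0r. Qed.

Lemma dot0r d (u : 'cV[R]_d) : dot u 0 = 0.
Proof. by rewrite dotC dot0l. Qed.

Definition dotE := (dotDl, dotDr, dotNl, dotNr, dotZl, dotZr).

Lemma dot_suml d (I : Type) (r : seq I) (Q : pred I) (F : I -> 'cV[R]_d) u :
  dot (\sum_(i <- r | Q i) F i) u = \sum_(i <- r | Q i) dot (F i) u.
Proof.
by elim/big_rec2: _ => [|i a b _ <-]; rewrite ?dot0l ?dotDl.
Qed.

Lemma dot_sumr d (I : Type) (r : seq I) (Q : pred I) (F : I -> 'cV[R]_d) u :
  dot u (\sum_(i <- r | Q i) F i) = \sum_(i <- r | Q i) dot u (F i).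
Proof. by rewrite dotC dot_suml; apply: eq_bigr => i _; rewrite dotC. Qed.

Lemma dot_mulmxl m d (A : 'M[R]_(m, d)) u v : dot (A *m u) v = dot u (A^T *m v).
Proof.
rewrite /dot; under eq_bigr do rewrite mxE mulr_suml.
rewrite exchange_big; apply: eq_bigr => j _; rewrite mxE mulr_sumr.
by apply: eq_bigr => i _; rewrite mxE; ring.
Qed.

Lemma dotvv_ge0 d (u : 'cV[R]_d) : 0 <= dot u u.
Proof. by apply: sumr_ge0 => i _; rewrite -expr2 sqr_ge0. Qed.

Lemma dotvv_eq0 d (u : 'cV[R]_d) : (dot u u == 0) = (u == 0).
Proof.
apply/idP/eqP => [|->]; last by rewrite dot0l.
rewrite psumr_eq0 => [/allP u0|i _]; last by rewrite -expr2 sqr_ge0.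
apply/colP => i; rewrite mxE; apply/eqP.
by have := u0 i (mem_index_enum _); rewrite mulf_eq0 orbb.
Qed.

Lemma sqr_norm2 d (u : 'cV[R]_d) : norm2 u ^+ 2 = dot u u.
Proof. by rewrite sqr_sqrtr // dotvv_ge0. Qed.

Lemma norm2_ge0 d (u : 'cV[R]_d) : 0 <= norm2 u.
Proof. exact: sqrtr_ge0. Qed.

Lemma norm2Z d (a : R) (u : 'cV[R]_d) : norm2 (a *: u) = `|a| * norm2 u.
Proof.
by rewrite /norm2 !dotE mulrA -expr2 sqrtrM ?sqr_ge0 // sqrtr_sqr.
Qed.

Lemma dot_young d (u v : 'cV[R]_d) :
  dot u v <= 2^-1 * dot u u + 2^-1 * dot v v.
Proof. have := dotvv_ge0 (u - v); rewrite !dotE (dotC v u); lra. Qed.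

Lemma cauchy_schwarz d (u v : 'cV[R]_d) : dot u v <= norm2 u * norm2 v.
Proof.
have [->|u0] := eqVneq u 0; first by rewrite dot0l mulr_ge0 ?norm2_ge0.
have [->|v0] := eqVneq v 0; first by rewrite dot0r mulr_ge0 ?norm2_ge0.
have lt0 (w : 'cV[R]_d) : w != 0 -> 0 < norm2 w.
  by move=> w0; rewrite sqrtr_gt0 lt_neqAle dotvv_ge0 eq_sym dotvv_eq0 w0.
have /lt0 nu := u0; have /lt0 nv := v0.
(* Expanded, this square is [2 |u| |v| (|u| |v| - <u, v>)]. *)
have := dotvv_ge0 (norm2 v *: u - norm2 u *: v).
rewrite !dotE (dotC v u) -!sqr_norm2 => H.
have : 0 <= (norm2 u * norm2 v) * (norm2 u * norm2 v - dot u v) by nra.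
by rewrite pmulr_rge0 ?mulr_gt0 // subr_ge0.
Qed.

Lemma dot_sym d (M : 'M[R]_d) u v : M^T = M -> dot (M *m u) v = dot (M *m v) u.
Proof. by move=> sM; rewrite dot_mulmxl sM dotC. Qed.

Lemma dot_sym_three_points d (M : 'M[R]_d) a b c : M^T = M ->
  dot (M *m (a - b)) (b - c) =
  2^-1 * dot (M *m (a - c)) (a - c) - 2^-1 * dot (M *m (b - c)) (b - c)
  - 2^-1 * dot (M *m (a - b)) (a - b).
Proof.
move=> sM; rewrite !mulmxBr !dotE (dot_sym c a sM) (dot_sym c b sM).
rewrite (dot_sym b a sM); lra.
Qed.

Lemma spd_unitmx d (M : 'M[R]_d) : spd M -> M \in unitmx.
Proof.
move=> [sM posM]; rewrite -row_free_unit; apply/row_freeP.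
suff /row_freeP : row_free M by [].
rewrite -kermx_eq0; apply/rowV0P => v /sub_kermxP vM.
apply: trmx_inj; rewrite trmx0; apply/eqP/negP => /negP v0.
by have := posM _ v0; rewrite -{1}sM -trmx_mul vM trmx0 dot0l ltxx.
Qed.

Lemma spd_invmx d (M : 'M[R]_d) : spd M -> spd (invmx M).
Proof.
move=> Mspd; have uM := spd_unitmx Mspd; case: (Mspd) => sM posM.
split=> [|u u0]; first by rewrite trmx_inv sM.
have := posM (invmx M *m u); rewrite mulKVmx // dotC; apply.
by apply: contra_neq u0 => Mu0; rewrite -[u](mulKVmx uM) Mu0 mulmx0.
Qed.

Lemma spd_ge0 d (M : 'M[R]_d) u : spd M -> 0 <= dot (M *m u) u.
Proof.
move=> [_ posM]; have [->|/posM/ltW //] := eqVneq u 0.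
by rewrite mulmx0 dot0l.
Qed.

Lemma dot_sqrtmx d (M B : 'M[R]_d) u :
  is_sqrtmx M B -> dot (B *m u) (B *m u) = dot (M *m u) u.
Proof. by move=> [[sB _] <-]; rewrite -mulmxA dot_sym // dotC -dot_mulmxl sB. Qed.

End Dot.

(** * Smooth convex functions *)

Section Smooth.
Context {R : realType}.

(** Stands in for letting t tend to 0 after dividing a first-order expansion by t. *)
Lemma ge0_of_small (e c : R) :
  (forall t, 0 < t < 1 -> 0 <= e + t * c) -> 0 <= e.
Proof.
move=> H; rewrite leNgt; apply/negP => e0.
have c1 : 0 < `|c| + 1 by rewrite ltr_wpDl.
have d0 : 0 < - e + (`|c| + 1) by lra.
(* If e < 0, this t lies below 1/2 and keeps [t * c] at most [- e / 2], so [e + t * c] stays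
   negative. *)
set t := - e / (- e + (`|c| + 1)) / 2.
have t01 : 0 < t < 1.
  rewrite !divr_gt0 //=; last by lra.
  by rewrite /t -mulrA -invfM ltr_pdivrMr; lra.
have : t * c <= - e / 2.
  have -> : t * c = - e / 2 * (c / (- e + (`|c| + 1))).
    by rewrite /t; field; lra.
  rewrite ler_piMr; [by []|lra|].
  by rewrite ler_pdivrMr // mul1r; have := ler_norm c; lra.
have := H t t01; lra.
Qed.

Lemma derive_grad d (h : 'cV[R]_d -> R) (x v : 'cV[R]_d) :
  differentiable h x -> 'D_v h x = dot (grad h x) v.
Proof.
move=> dh; rewrite deriveE //.
have {1}-> : v = \sum_i v i 0 *: delta_mx i 0.
  by rewrite {1}[v]matrix_sum_delta; apply: eq_bigr => i _; rewrite big_ord1.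
rewrite linear_sum; apply: eq_bigr => i _.
by rewrite linearZ mxE /= deriveE // mulrC.
Qed.

Lemma is_derive_line d (h : 'cV[R]_d -> R) (x v : 'cV[R]_d) (t : R) :
  differentiable h (x + t *: v) ->
  is_derive t 1 (fun t : R => h (x + t *: v)) (dot (grad h (x + t *: v)) v).
Proof.
move=> dh; have dv : derivable h (x + t *: v) v by exact: diff_derivable.
have [D1 D2] : is_derive (x + t *: v) v h (dot (grad h (x + t *: v)) v).
  by rewrite -(derive_grad v dh); exact: derivableP.
(* The difference quotient of h in direction v coincides with that of its restriction to the line in
   direction 1. *)
have eq : (fun s : R => s^-1 *: ((h \o shift (x + t *: v)) (s *: v) - h (x + t *: v)))
  = (fun s : R => s^-1 *: (((fun t : R => h (x + t *: v)) \o shift t) (s *: 1)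
                           - h (x + t *: v))).
  apply: funext => s /=; rewrite addrCA scalerDl.
  by rewrite [(s *: 1)%R]mulr1.
by split; rewrite ?/derivable ?/derive -eq.
Qed.

(** The descent lemma in two-sided form. The mean value theorem on [0, 1] is applied to the
    linearization error minus its quadratic bound, whose derivative is nonpositive by Cauchy-Schwarz
    and the Lipschitz condition. *)
Lemma smooth_quadratic_bound d (h : 'cV[R]_d -> R) (L : R) (x v : 'cV[R]_d) :
  0 <= L -> (forall x, differentiable h x) ->
  (forall x x', norm2 (grad h x - grad h x') <= L * norm2 (x - x')) ->
  `|h (x + v) - h x - dot (grad h x) v| <= L / 2 * dot v v.
Proof.
move=> L0 dh lip; rewrite ler_norml.
(* The sign s treats the upper and the lower bound at once. *)
suff H (s : R) : `|s| = 1 ->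
    s * (h (x + v) - h x - dot (grad h x) v) <= L / 2 * dot v v.
  have := H 1 (normr1 _); have := H (-1) (normrN1 _); lra.
move=> s1; set a := dot (grad h x) v.
pose g (t : R) := h (x + t *: v).
pose f : R -> R := s \*: (g - a \*: id) - (L / 2 * dot v v) \*: (id ^+ 2).
pose df t := s * (dot (grad h (x + t *: v)) v - a) - L * dot v v * t.
have fE t : f t = s * (g t - a * t) - (L / 2 * dot v v) * t ^+ 2 by [].
have fD (t : R) : is_derive t 1 f (df t).
  have gD : is_derive t 1 g (dot (grad h (x + t *: v)) v) by exact: is_derive_line.
  apply: is_derive_eq; rewrite /df; set D := dot _ v.
  transitivity (s * (D - a * 1) - L / 2 * dot v v * (2 * t ^+ 1 * 1)) => //.
  by field.
have [|c] := @MVT R f df 0 1 ltr01 (fun t _ => fD t).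
  apply: continuous_subspaceT => t; apply: differentiable_continuous.
  by apply/derivable1_diffP; case: (fD t).
rewrite in_itv /= => /andP[c0 c1].
rewrite !fE /g scale0r addr0 scale1r subr0 mulr1 => Heq.
suff : df c <= 0 by move: Heq; rewrite -/a; lra.
have := cauchy_schwarz (s *: (grad h (x + c *: v) - grad h x)) v.
rewrite norm2Z s1 mul1r dotZl dotDl dotNl -/a => /le_trans; rewrite subr_le0; apply.
have := lip (x + c *: v) x; rewrite [x + _ - x]addrAC subrr add0r norm2Z gtr0_norm // => lipc.
have := ler_wpM2r (norm2_ge0 v) lipc.
by rewrite -sqr_norm2; lra.
Qed.

Lemma convex_functionE d (h : 'cV[R]_d -> R) (x y : 'cV[R]_d) t :
  convex_function setT h -> 0 < t < 1 ->
  h (t *: x + (1 - t) *: y) <= t * h x + (1 - t) * h y.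
Proof.
move=> hcvx /andP[t0 t1].
have := hcvx (Itv01 (ltW t0) (ltW t1)) x y.
by rewrite !inE => /(_ I I).
Qed.

Lemma convex_setE d (X : set 'cV[R]_d) (x y : 'cV[R]_d) t :
  convex_set X -> 0 < t < 1 -> X x -> X y -> X (t *: x + (1 - t) *: y).
Proof.
move=> Xcvx /andP[t0 t1].
have := Xcvx x y (Itv01 (ltW t0) (ltW t1)).
by rewrite !inE => H Xx Xy; exact: (H Xx Xy).
Qed.

Lemma convex_set_setT d : convex_set [set: 'cV[R]_d].
Proof. by move=> ? ? ? _ _; rewrite inE. Qed.

(** Convexity on the segment from x to x + v is compared with the quadratic bound at [t *: v]; after
    division by t the remainder is of order t. *)
Lemma convex_gradient d (h : 'cV[R]_d -> R) (L : R) (x v : 'cV[R]_d) :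
  convex_function setT h ->
  0 <= L -> (forall x, differentiable h x) ->
  (forall x x', norm2 (grad h x - grad h x') <= L * norm2 (x - x')) ->
  h x + dot (grad h x) v <= h (x + v).
Proof.
move=> hcvx L0 dh lip; rewrite -subr_ge0.
apply: (@ge0_of_small _ (L / 2 * dot v v)) => t /[dup] t01 /andP[t0 t1].
have := smooth_quadratic_bound x (t *: v) L0 dh lip.
have := convex_functionE (x + v) x hcvx t01.
have -> : t *: (x + v) + (1 - t) *: x = x + t *: v.
  by rewrite scalerDr scalerBl scale1r addrAC addrCA subrr addr0.
rewrite ler_norml !dotE => cvx /andP[low _].
rewrite -(pmulr_rge0 _ t0); lra.
Qed.


End Smooth.

(** * Proximal operators and conjugates *)

Section Prox.
Context {R : realType}.

Lemma prox_fin d (X : set 'cV[R]_d) T (phi : 'cV[R]_d -> \bar R) u z :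
  (forall x, (-oo < phi x)%E) -> (exists2 x, X x & (phi x < +oo)%E) ->
  prox X T phi u z -> phi z \is a fin_num.
Proof.
move=> phiN [x Xx phix] [_ /(_ x Xx)].
by move: phix (phiN x) (phiN z); case: (phi x) => [r| |] //; case: (phi z).
Qed.

(** First-order optimality: the minimizer z competes with [t *: z' + (1 - t) *: z], and the
    quadratic term of the expansion is of order t after division by t. *)
Lemma prox_variational d (X : set 'cV[R]_d) T (phi : 'cV[R]_d -> \bar R) u z z' :
  convex_set X -> (forall x, (-oo < phi x)%E) -> econvex phi ->
  (invmx T)^T = invmx T ->
  prox X T phi u z -> X z' -> phi z \is a fin_num -> phi z' \is a fin_num ->
  fine (phi z) <= fine (phi z') + dot (invmx T *m (u - z)) (z - z').
Proof.
move=> Xcvx phiN cphi sT [Xz zmin] Xz' fz fz'.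
set M := invmx T in sT zmin *; rewrite -subr_ge0.
apply: (@ge0_of_small _ _ (2^-1 * dot (M *m (z' - z)) (z' - z))).
move=> t /[dup] t01 /andP[t0 t1].
have Xt := convex_setE Xcvx t01 Xz' Xz.
have := zmin _ Xt; rewrite -(fineK fz).
have := cphi z' z t t01; rewrite -(fineK fz) -(fineK fz') -!EFinM -EFinD.
have := phiN (t *: z' + (1 - t) *: z).
case: (phi (_ + _)) => [r| |] //= _; rewrite -?EFinD !lee_fin.
have -> : t *: z' + (1 - t) *: z - u = (z - u) + t *: (z' - z).
  by apply/colP => i; rewrite !mxE; ring.
have -> : u - z = - (z - u) by rewrite opprB.
have -> : z - z' = - (z' - z) by rewrite opprB.
move: (z - u) (z' - z) => a b.
rewrite mulmxDr mulmxN -!scalemxAr !dotE (dot_sym b a sT) => H1 H2.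
rewrite -(pmulr_rge0 _ t0); lra.
Qed.

(** Adding the variational inequalities of the two minimizers bounds the [invmx T]-square of z - z'
    by 0. *)
Lemma prox_unique d (X : set 'cV[R]_d) T (phi : 'cV[R]_d -> \bar R) u z z' :
  convex_set X -> (forall x, (-oo < phi x)%E) -> econvex phi ->
  (exists2 x, X x & (phi x < +oo)%E) -> spd T ->
  prox X T phi u z -> prox X T phi u z' -> z = z'.
Proof.
move=> Xcvx phiN cphi domphi /spd_invmx [sM posM] zP z'P.
have fz := prox_fin phiN domphi zP; have fz' := prox_fin phiN domphi z'P.
have := prox_variational Xcvx phiN cphi sM zP z'P.1 fz fz'.
have := prox_variational Xcvx phiN cphi sM z'P zP.1 fz' fz.
have [//|zz'] := eqVneq z z'.
have := posM (z - z'); rewrite subr_eq0 zz' => /(_ isT) => lt1 le1 le2.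
suff : False by []; move: lt1 le1 le2.
rewrite !mulmxBr !dotE; lra.
Qed.

Lemma conjugate_gtNy d (f : 'cV[R]_d -> \bar R) y :
  eproper f -> (-oo < conjugate f y)%E.
Proof.
move=> [fN [z fz]]; apply: lt_le_trans (ereal_sup_ubound _); last by exists z.
by move: fz (fN z); case: (f z) => [r| |] //= _ _; rewrite ltNye.
Qed.

Lemma conjugate_convex d (f : 'cV[R]_d -> \bar R) :
  eproper f -> econvex (conjugate f).
Proof.
move=> fprop x y t /andP[t0 t1]; have t1' : 0 < 1 - t by rewrite subr_gt0.
apply: ge_ereal_sup => _ [z _ <-].
have [fN _] := fprop; have := fN z.
have ub w : ((dot z w)%:E - f z <= conjugate f w)%E.
  by apply: ereal_sup_ubound; exists z.
have := ub x; have := ub y.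
case: (f z) => [r| |] //= Hy Hx _; last by rewrite leNye.
have -> : ((dot z (t *: x + (1 - t) *: y))%:E - r%:E =
   t%:E * ((dot z x)%:E - r%:E) + (1 - t)%:E * ((dot z y)%:E - r%:E))%E.
  by rewrite !dotE -!EFinB -!EFinM -EFinD; congr EFin; ring.
by apply: leeD; apply: lee_wpmul2l => //; rewrite lee_fin ltW.
Qed.

(** Jensen's inequality for a relation Q, thought of as an epigraph, so that membership in X and
    finiteness can be averaged together with a bound. *)
Lemma ergodic_avg_jensen d (Q : 'cV[R]_d -> R -> Prop)
    (u : nat -> 'cV[R]_d) (a : nat -> R) :
  (forall v w b c t, 0 < t < 1 -> Q v b -> Q w c ->
     Q (t *: v + (1 - t) *: w) (t * b + (1 - t) * c)) ->
  forall K, (0 < K)%N -> (forall k, (0 < k <= K)%N -> Q (u k) (a k)) ->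
  Q (ergodic_avg u K) (K%:R^-1 * \sum_(1 <= k < K.+1) a k).
Proof.
move=> Qcvx; elim=> // -[_ _ Qk|K IH _ Qk].
  by rewrite /ergodic_avg !big_nat1 invr1 scale1r mul1r; exact: Qk.
have K0 : 0 < K.+1%:R :> R by rewrite ltr0n.
(* The weight of the old average when term K + 2 joins it. *)
pose t : R := K.+1%:R / K.+2%:R.
have tE : 1 - t = K.+2%:R^-1.
  by rewrite /t -[K.+2%:R]natr1; field; lra.
have t01 : 0 < t < 1.
  by rewrite divr_gt0 ?ltr0n //= ltr_pdivrMr ?ltr0n // mul1r ltr_nat.
have tK : t / K.+1%:R = K.+2%:R^-1 by rewrite /t mulrAC divff ?mul1r // pnatr_eq0.
have -> : ergodic_avg u K.+2 = t *: ergodic_avg u K.+1 + (1 - t) *: u K.+2.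
  by rewrite /ergodic_avg big_nat_recr //= scalerDr scalerA tK tE.
have -> : K.+2%:R^-1 * \sum_(1 <= k < K.+3) a k =
    t * (K.+1%:R^-1 * \sum_(1 <= k < K.+2) a k) + (1 - t) * a K.+2.
  by rewrite big_nat_recr //= mulrDr mulrA tK tE.
apply: Qcvx => //; last by apply: Qk; rewrite leqnn.
by apply: IH => // k /andP[k0 kK]; apply: Qk; rewrite k0 leqW.
Qed.

End Prox.

(** * Sample histories *)

Section History.
Context {R : realType} {n : nat} {dd : measure_display} {Omega : measurableType dd}.
Variables (P : probability Omega R) (law : {set 'I_n} -> R).
Variable Sk : nat -> Omega -> {set 'I_n}.

Definition hist K w : K.-tuple {set 'I_n} := [tuple Sk k w | k < K].

Definition weight K (t : K.-tuple {set 'I_n}) : R := \prod_(k < K) law (tnth t k).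

Lemma histP K w w' :
  hist K w = hist K w' -> forall k, (k < K)%N -> Sk k w = Sk k w'.
Proof.
move=> /(congr1 (fun t => tnth t)) E k kK.
by have := congr1 (fun f => f (Ordinal kK)) E; rewrite /= !tnth_mktuple.
Qed.

Lemma histS K w : hist K.+1 w = rcons_tuple (hist K w) (Sk K w).
Proof.
by apply: val_inj => /=; rewrite enum_ordSr map_rcons -map_comp.
Qed.

Lemma weight_rcons K (t : K.-tuple {set 'I_n}) J :
  weight (rcons_tuple t J) = weight t * law J.
Proof.
rewrite /weight big_ord_recr /=; congr (_ * law _).
  by apply: eq_bigr => k _; rewrite !(tnth_nth J) /= nth_rcons size_tuple ltn_ord.
by rewrite (tnth_nth J) /= nth_rcons size_tuple ltnn eqxx.
Qed.

Lemma sum_rcons K (V : nmodType) (phi : K.+1.-tuple {set 'I_n} -> V) :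
  \sum_t phi t = \sum_(t : K.-tuple {set 'I_n}) \sum_J phi (rcons_tuple t J).
Proof.
rewrite pair_bigA /=.
pose g (u : K.+1.-tuple {set 'I_n}) :=
  ([tuple tnth u (widen_ord (leqnSn K) k) | k < K], tnth u ord_max).
rewrite (reindex (fun p : K.-tuple {set 'I_n} * {set 'I_n} => rcons_tuple p.1 p.2)) //=.
exists g => [[t J] _|u _].
  rewrite /g /=; congr pair; last by rewrite (tnth_nth J) /= nth_rcons size_tuple ltnn eqxx.
  apply: eq_from_tnth => k; rewrite tnth_mktuple !(tnth_nth J) /= nth_rcons.
  by rewrite size_tuple ltn_ord.
have : forall k, tnth (g u).1 k = tnth u (widen_ord (leqnSn K) k).
  by move=> k; rewrite tnth_mktuple.
move: (g u).1 => t tE; apply: eq_from_tnth => k.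
rewrite (tnth_nth (tnth u ord_max)) /= nth_rcons size_tuple.
have [kK|Kk] := ltnP k K.
  rewrite -[X in nth _ _ X]/(val (Ordinal kK)) -tnth_nth tE.
  by congr tnth; apply: val_inj.
have -> : k = ord_max by apply: val_inj; apply/eqP; rewrite eqn_leq Kk -ltnS ltn_ord.
by rewrite eqxx.
Qed.

Hypothesis sampling : iid_sampling P law Sk.

Lemma law_ge0 J : 0 <= law J.
Proof. by case: sampling => _ /(_ 0%N J) PJ _; rewrite -lee_fin -PJ. Qed.

Lemma measurable_hist K t : measurable [set w | hist K w = t].
Proof.
have -> : [set w | hist K w = t] =
    \bigcap_(k : 'I_K) [set w | Sk k w = tnth t k].
  apply/seteqP; split=> w /= => [<- k _|H]; first by rewrite /= tnth_mktuple.
  by apply: eq_from_tnth => k; rewrite tnth_mktuple; exact: H.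
by case: sampling => mS _ _; apply: fin_bigcap_measurable => // k _; exact: mS.
Qed.

Lemma P_hist K t : P [set w | hist K w = t] = (weight t)%:E.
Proof.
case: sampling => _ Plaw indep.
(* Singletons put the history event into the form of the independence clause. *)
pose E (k : nat) : {set {set 'I_n}} := [set J in [:: nth finset.set0 t k]].
have -> : [set w | hist K w = t] = [set w | forall k, k \in iota 0 K -> Sk k w \in E k].
  apply/seteqP; split=> w /= => [wt k|H].
    rewrite mem_iota /= add0n => kK.
    rewrite !inE; apply/eqP; rewrite -[k]/(val (Ordinal kK)) -tnth_nth.
    by rewrite -wt tnth_mktuple.
  apply: eq_from_tnth => k; rewrite tnth_mktuple (tnth_nth finset.set0).
  apply/eqP; have := H k; rewrite mem_iota /= add0n ltn_ord => /(_ isT).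
  by rewrite !inE.
rewrite indep ?iota_uniq // /weight.
rewrite (eq_bigr (fun k => (law (nth finset.set0 t k))%:E)); last first.
  move=> k _; rewrite -(Plaw k); congr (P _).
  by apply/seteqP; split=> w /=; rewrite !inE => /eqP.
have -> : \prod_(k < K) law (tnth t k) = \prod_(k <- iota 0 K) law (nth finset.set0 t k).
  rewrite -[K in iota 0 K]subn0 big_mkord.
  by apply: eq_bigr => k _; rewrite (tnth_nth finset.set0).
exact: prodEFin.
Qed.

Lemma weight_ge0 K (t : K.-tuple {set 'I_n}) : 0 <= weight t.
Proof. by apply: prodr_ge0 => k _; exact: law_ge0. Qed.

Lemma weight_gt0_hist K (t : K.-tuple {set 'I_n}) :
  0 < weight t -> exists w, hist K w = t.
Proof.
move=> t0; apply: contrapT => noW.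
have : P [set w | hist K w = t] = 0.
  by rewrite (_ : [set w | _] = set0) ?measure0 // -subset0 => w wt; apply: noW; exists w.
by rewrite P_hist => -[] t00; rewrite t00 ltxx in t0.
Qed.

(** A function of the history is a finite combination of indicators of history events, so
    measurability reduces to that of these events. *)
Lemma integral_hist K (F : K.-tuple {set 'I_n} -> \bar R) :
  (forall t, (0 <= F t)%E) ->
  (\int[P]_w F (hist K w) = \sum_t F t * (weight t)%:E)%E.
Proof.
move=> F0.
pose G t w : \bar R := (F t * (\1_[set w | hist K w = t] w)%:E)%E.
have GE w : F (hist K w) = (\sum_t G t w)%E.
  rewrite (bigD1 (hist K w)) //= big1 ?adde0; last first.
    by move=> t tw; rewrite /G indicE memNset ?mule0 // => /esym/eqP; exact/negP.
  by rewrite /G indicE mem_set // mule1.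
under eq_integral => w _ do rewrite GE.
have mG t : measurable_fun setT (fun w => (\1_[set w | hist K w = t] w)%:E : \bar R).
  by apply/measurable_EFinP; apply: measurable_indic; exact: measurable_hist.
rewrite ge0_integral_sum //.
- apply: eq_bigr => t _; rewrite ge0_integralZl //; congr (_ * _)%E.
  rewrite integral_indic ?setIT //; last exact: measurable_hist.
  exact: P_hist.
- by move=> t; exact: measurable_funeM.
- by move=> t w _; rewrite mule_ge0 // lee_fin.
Qed.

Lemma sum_law : \sum_J law J = 1.
Proof.
(* Total mass 1, computed over histories of length one. *)
have := @integral_hist 1 (cst 1%E) (fun=> lee01).
rewrite integral_cst // mul1e => /esym E; have {E} := etrans E (probability_setT P).
rewrite sum_rcons (big_pred1 [tuple]) => [|t]; last by apply/esym/eqP; exact: tuple0.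
under eq_bigr do rewrite weight_rcons /weight big_ord0 mul1r mul1e.
by rewrite sumEFin => -[].
Qed.

(** * Expectations as finite sums over histories *)

Definition expect K (phi : K.-tuple {set 'I_n} -> R) : R := \sum_t weight t * phi t.

Lemma expect_le K (phi psi : K.-tuple {set 'I_n} -> R) :
  (forall t, 0 < weight t -> phi t <= psi t) -> expect phi <= expect psi.
Proof.
move=> le; apply: ler_sum => t _.
have := weight_ge0 t; rewrite le_eqVlt => /orP[/eqP <-|t0]; first by rewrite !mul0r.
by rewrite ler_pM2l // le.
Qed.

(** The tower property: weights are products, so the last sample can be averaged first, with law
    [law]. *)
Lemma expectS K (phi : K.+1.-tuple {set 'I_n} -> R) :
  expect phi = expect (fun t => \sum_J law J * phi (rcons_tuple t J)).
Proof.
rewrite /expect sum_rcons; apply: eq_bigr => t _; rewrite mulr_sumr.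
by apply: eq_bigr => J _; rewrite weight_rcons mulrA.
Qed.

(* Junk value when no outcome has history [t]; this never happens when [t] has
   positive weight. *)
Definition history_rep K (t : K.-tuple {set 'I_n}) : Omega :=
  xget point [set w | hist K w = t].

Lemma history_repP K (t : K.-tuple {set 'I_n}) :
  0 < weight t -> hist K (history_rep t) = t.
Proof.
move=> /weight_gt0_hist[w wt].
by have /(xgetPex point) : exists w, [set w | hist K w = t] w by exists w.
Qed.

Lemma history_rep_rcons K (t : K.-tuple {set 'I_n}) J : 0 < weight t -> 0 < law J ->
  hist K (history_rep (rcons_tuple t J)) = t /\
  Sk K (history_rep (rcons_tuple t J)) = J.
Proof.
move=> t0 J0; have : 0 < weight (rcons_tuple t J) by rewrite weight_rcons mulr_gt0.
move=> /history_repP; rewrite histS => /(congr1 val) /= /rcons_inj[tt' ->].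
by split=> //; exact: val_inj.
Qed.

Lemma weight_gt0_law K (t : K.-tuple {set 'I_n}) : 0 < weight t ->
  forall j, (j < K)%N -> 0 < law (Sk j (history_rep t)).
Proof.
move=> t0 j jK; have /(congr1 (fun t => tnth t (Ordinal jK))) := history_repP t0.
rewrite tnth_mktuple /= => ->.
rewrite lt_neqAle law_ge0 andbT eq_sym; apply: contraTneq t0 => tj0.
by rewrite /weight (bigD1 (Ordinal jK)) //= tj0 mul0r ltxx.
Qed.

Lemma inclusion_prob_le1 i : inclusion_prob law i <= 1.
Proof.
rewrite -sum_law [leRHS](bigID (fun J : {set 'I_n} => i \in J)) /= lerDl.
by apply: sumr_ge0 => J _; exact: law_ge0.
Qed.

(** Used for a block skipped by a possible sample: such a block has p_i < 1, which brings it under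
    the assumption on the initial dual point. *)
Lemma inclusion_prob_lt1 i J : 0 < law J -> i \notin J -> inclusion_prob law i < 1.
Proof.
move=> J0 iJ; rewrite -sum_law [ltRHS](bigID (fun J : {set 'I_n} => i \in J)) /=.
rewrite ltrDl (bigD1 J) //= ltr_wpDr //.
by apply: sumr_ge0 => J' _; exact: law_ge0.
Qed.

End History.

(** * The one-step inequality *)

Section Step.
Context {R : realType} {d m n : nat}.
Variables (X : set 'cV[R]_d) (A : 'I_n -> 'M[R]_(m, d)).
Variables (F : 'I_n -> 'cV[R]_m -> \bar R) (g : 'cV[R]_d -> \bar R).
Variables (h : 'cV[R]_d -> R) (L : R) (xs : 'cV[R]_d) (ys : 'I_n -> 'cV[R]_m).
Variables (law : {set 'I_n} -> R) (T : 'M[R]_d) (S : 'I_n -> 'M[R]_m).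
Variables (Shalf : 'I_n -> 'M[R]_m) (TLhalf : 'M[R]_d).

Local Notation p := (inclusion_prob law).

(** * Gaps, Lyapunov function and ESO terms *)

Definition primal_sq (u : 'cV[R]_d) := dot (invmx T *m u) u.
Definition dual_sq i (v : 'cV[R]_m) := dot (invmx (S i) *m v) v.

Definition primal_gap x : R :=
  h x + fine (g x) - h xs - fine (g xs) + \sum_i dot (A i *m (x - xs)) (ys i).

Definition dual_gap i y : R :=
  fine (F i y) - fine (F i (ys i)) - dot (A i *m xs) (y - ys i).

Definition coupling v (y yp : 'I_n -> 'cV[R]_m) : R :=
  \sum_i (p i)^-1 * dot (A i *m v) (y i - yp i).

Definition lyapunov x y yp : R :=
  2^-1 * primal_sq (x - xs)
  + \sum_i ((2 * p i)^-1 * dual_sq i (y i - ys i) + ((p i)^-1 - 1) * dual_gap i (y i))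
  - coupling (x - xs) y yp.

(** The factor 1 / p_i makes the mean over the next sample equal to half the squared distance moved
    by a full dual update. *)
Definition move_sq (y yp : 'I_n -> 'cV[R]_m) : R :=
  \sum_i (2 * p i)^-1 * dual_sq i (y i - yp i).

Definition eso_block i : 'M[R]_(m, d) := Shalf i *m A i *m invmx TLhalf.

(** Chosen so that S^{1/2} in [eso_block] cancels: block times vector is (T^{-1} - L)^{-1/2} A_i^T
    (y_i - yp_i) / p_i, which vanishes on blocks that were not updated. *)
Definition eso_vec (y yp : 'I_n -> 'cV[R]_m) i : 'cV[R]_m :=
  (p i)^-1 *: (invmx (Shalf i) *m (y i - yp i)).

Definition coupling_sq (y yp : 'I_n -> 'cV[R]_m) : R :=
  2^-1 * norm2 (\sum_i (eso_block i)^T *m eso_vec y yp i) ^+ 2.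

Hypotheses (X_convex : convex_set X).
Hypotheses (F_gtNy : forall i y, (-oo < F i y)%E) (F_convex : forall i, econvex (F i)).
Hypotheses (g_gtNy : forall x, (-oo < g x)%E) (g_convex : econvex g).
Hypotheses (h_convex : convex_function setT h).
Hypotheses (h_diff : forall x, differentiable h x) (L_ge0 : 0 <= L).
Hypothesis h_lip : forall x x', norm2 (grad h x - grad h x') <= L * norm2 (x - x').
Hypotheses (Xxs : X xs) (g_xs : g xs \is a fin_num).
Hypothesis F_ys : forall i, F i (ys i) \is a fin_num.
Hypotheses (law_ge0 : forall J, 0 <= law J) (sum_law : \sum_J law J = 1).
Hypothesis p_gt0 : forall i, 0 < p i.
Hypotheses (T_spd : spd T) (S_spd : forall i, spd (S i)).
Hypotheses (Shalf_sqrt : forall i, is_sqrtmx (S i) (Shalf i)).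
Hypotheses (TLhalf_sqrt : is_sqrtmx (invmx T - L%:M) TLhalf).

(** The prox inequality is tested at x*. The descent lemma from x to x' costs L/2 |x' - x|^2,
    turning T^{-1} into T^{-1} - L, and the gradient inequality from x to x* supplies the convexity
    of h. *)
Lemma primal_step x ybar x' :
  prox X T g (x - T *m (\sum_i (A i)^T *m ybar i + grad h x)) x' ->
  primal_gap x' <= 2^-1 * primal_sq (x - xs) - 2^-1 * primal_sq (x' - xs)
    - 2^-1 * dot ((invmx T - L%:M) *m (x' - x)) (x' - x)
    - \sum_i dot (A i *m (x' - xs)) (ybar i - ys i).
Proof.
move=> x'P; have gx' : g x' \is a fin_num.
  apply: prox_fin x'P => //; exists xs => //.
  by rewrite ltey_eq g_xs.
have [sT _] := spd_invmx T_spd.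
have := prox_variational X_convex g_gtNy g_convex sT x'P Xxs gx' g_xs.
have -> : invmx T *m (x - T *m (\sum_i (A i)^T *m ybar i + grad h x) - x')
    = invmx T *m (x - x') - \sum_i (A i)^T *m ybar i - grad h x.
  rewrite addrAC mulmxDr mulmxN mulKmx ?spd_unitmx // opprD addrA.
  by [].
have := smooth_quadratic_bound x (x' - x) L_ge0 h_diff h_lip.
rewrite ler_norml => /andP[_]; rewrite [x + _]addrC subrK.
have := convex_gradient x (xs - x) h_convex L_ge0 h_diff h_lip.
rewrite [x + _]addrC subrK.
rewrite /primal_gap /primal_sq mulmxBl mul_scalar_mx.
have -> : \sum_i dot (A i *m (x' - xs)) (ybar i - ys i)
  = dot (\sum_i (A i)^T *m ybar i) (x' - xs) - \sum_i dot (A i *m (x' - xs)) (ys i).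
  rewrite dot_suml -sumrB; apply: eq_bigr => i _.
  by rewrite [in RHS]dotC -dot_mulmxl -dotNr -dotDr.
have := dot_sym_three_points x x' xs sT.
move=> E.
rewrite (dotDl _ _ (x' - xs)) (dotDl _ _ (x' - xs)) !dotNl E.
rewrite (dotDl (invmx T *m (x' - x))) dotNl dotZl.
have -> : dot (grad h x) (x' - xs) = dot (grad h x) (x' - x) - dot (grad h x) (xs - x).
  by rewrite -dotNr -dotDr opprB addrA subrK.
have -> : dot (invmx T *m (x' - x)) (x' - x) = dot (invmx T *m (x - x')) (x - x').
  by rewrite -[x' - x]opprB mulmxN !dotE opprK.
lra.
Qed.

(** The prox inequality tested at y*_i; the slope A_i x' of the step against the slope A_i x* in
    [dual_gap] leaves the bilinear term. *)
Lemma dual_step i x' y y' :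
  prox setT (S i) (F i) (y + S i *m (A i *m x')) y' ->
  dual_gap i y' <= 2^-1 * dual_sq i (y - ys i) - 2^-1 * dual_sq i (y' - ys i)
    - 2^-1 * dual_sq i (y' - y) + dot (A i *m (x' - xs)) (y' - ys i).
Proof.
move=> y'P; have Fy' : F i y' \is a fin_num.
  by apply: prox_fin y'P => //; exists (ys i) => //; rewrite ltey_eq F_ys.
have [sS _] := spd_invmx (S_spd i).
have := prox_variational (@convex_set_setT _ _) (F_gtNy i) (@F_convex i) sS y'P I Fy' (F_ys i).
have -> : invmx (S i) *m (y + S i *m (A i *m x') - y')
  = invmx (S i) *m (y - y') + A i *m x'.
  by rewrite addrAC mulmxDr mulKmx ?spd_unitmx.
have := dot_sym_three_points y y' (ys i) sS.
have -> : dot (invmx (S i) *m (y - y')) (y - y') = dual_sq i (y' - y).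
  by rewrite /dual_sq -[y' - y]opprB mulmxN dotNl dotNr opprK.
move=> E; rewrite (dotDl _ _ (y' - ys i)) E /dual_gap -/(dual_sq _ _) -/(dual_sq _ _).
rewrite mulmxBr (dotDl _ _ (y' - ys i)) dotNl; lra.
Qed.

(** Inserting (T^{-1} - L)^{1/2} and its inverse turns the coupling into one inner product, to which
    Young's inequality applies. *)
Lemma coupling_young v y yp :
  coupling v y yp <=
  2^-1 * dot ((invmx T - L%:M) *m v) v + coupling_sq y yp.
Proof.
have uTL : TLhalf \in unitmx by apply: spd_unitmx; exact: TLhalf_sqrt.1.
have -> : coupling v y yp
    = dot (TLhalf *m v) (\sum_i (eso_block i)^T *m eso_vec y yp i).
  rewrite dot_sumr; apply: eq_bigr => i _; rewrite -dot_mulmxl /eso_block.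
  have [sS _] := (Shalf_sqrt i).1.
  rewrite -!mulmxA mulKmx // /eso_vec dotZr [in RHS]dot_mulmxl sS mulKVmx //.
  exact: spd_unitmx (Shalf_sqrt i).1.
by rewrite -(dot_sqrtmx _ TLhalf_sqrt) /coupling_sq sqr_norm2 dot_young.
Qed.

(** Allows the final potential to be dropped: Young's inequality absorbs the coupling into the
    primal square, with L/2 |x - x*|^2 to spare. *)
Lemma lyapunov_coupling_ge0 x y yp :
  (forall i, 0 <= ((p i)^-1 - 1) * dual_gap i (y i)) ->
  0 <= lyapunov x y yp + coupling_sq y yp.
Proof.
move=> D0; have := coupling_young (x - xs) y yp.
rewrite mulmxBl mul_scalar_mx dotDl dotNl dotZl /lyapunov -/(primal_sq _).
have : 0 <= L * dot (x - xs) (x - xs) by rewrite mulr_ge0 ?dotvv_ge0.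
set s := \sum_i _.
have : 0 <= s.
  apply: sumr_ge0 => i _; rewrite addr_ge0 // mulr_ge0 ?spd_ge0 //.
    by rewrite invr_ge0 mulr_ge0 // ltW.
  exact: spd_invmx.
lra.
Qed.

(** * Averaging over the next sample *)

Section Conditional.
Variables (y hat : 'I_n -> 'cV[R]_m) (next : {set 'I_n} -> 'I_n -> 'cV[R]_m).
Hypothesis next_hat : forall J i, 0 < law J ->
  next J i = if i \in J then hat i else y i.

(** Samples are split by whether they contain i; [hat] is the full dual update. *)
Lemma sum_law_next i (phi : 'cV[R]_m -> R) :
  \sum_J law J * phi (next J i) = p i * phi (hat i) + (1 - p i) * phi (y i).
Proof.
rewrite -sum_law (bigID (fun J : {set 'I_n} => i \in J) xpredT law) /=.
rewrite [X in (X - _)]addrC -/(p i) addrK.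
rewrite (bigID (fun J : {set 'I_n} => i \in J)) /= !mulr_suml.
congr (_ + _); apply: eq_bigr => J iJ.
  have := law_ge0 J; rewrite le_eqVlt => /orP[/eqP <-|J0]; first by rewrite !mul0r.
  by rewrite next_hat // iJ.
have := law_ge0 J; rewrite le_eqVlt => /orP[/eqP <-|J0]; first by rewrite !mul0r.
by rewrite next_hat // (negbTE iJ).
Qed.

(** The ESO inequality is applied to the vectors of the full update. Its factor p_i cancels one of
    the two factors 1 / p_i of their squares, leaving v_i / p_i < 1. *)
Lemma eso_step v :
  eso law eso_block v -> (forall i, v i < p i) ->
  \sum_J law J * coupling_sq (next J) y <= \sum_J law J * move_sq (next J) y.
Proof.
move=> ESO vp; pose z i := eso_vec hat y i.
have zsq i : norm2 (z i) ^+ 2 = (p i)^-1 ^+ 2 * dual_sq i (hat i - y i).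
  rewrite sqr_norm2 /z /eso_vec dotZl dotZr mulrA -expr2; congr (_ * _).
  have [Sspd SS] := Shalf_sqrt i; have uS := spd_unitmx Sspd.
  apply: dot_sqrtmx; split; first exact: spd_invmx.
  rewrite -[LHS](mulKmx (spd_unitmx (S_spd i))) -{2}SS -!mulmxA.
  by rewrite mulKVmx // mulmxV // mulmx1.
have -> : \sum_J law J * move_sq (next J) y = \sum_i 2^-1 * dual_sq i (hat i - y i).
  under eq_bigr do rewrite /move_sq mulr_sumr.
  rewrite exchange_big; apply: eq_bigr => i _ /=.
  rewrite (@sum_law_next i (fun w => (2 * p i)^-1 * dual_sq i (w - y i))) subrr.
  rewrite /dual_sq dot0r; field; exact: lt0r_neq0.
have -> : \sum_J law J * coupling_sq (next J) y
    = 2^-1 * \sum_J law J * norm2 (\sum_(i in J) (eso_block i)^T *m z i) ^+ 2.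
  rewrite mulr_sumr; apply: eq_bigr => J _.
  have := law_ge0 J; rewrite le_eqVlt => /orP[/eqP <-|J0].
    by rewrite !mul0r mulr0.
  rewrite /coupling_sq mulrCA; congr (_ * (_ * norm2 _ ^+ 2)).
  rewrite [RHS]big_mkcond; apply: eq_bigr => i _.
  rewrite /z /eso_vec next_hat //; case: (i \in J) => //.
  by rewrite subrr mulmx0 scaler0 mulmx0.
rewrite -mulr_sumr ler_pM2l ?invr_gt0 ?ltr0n //.
apply: le_trans (ESO z) _; apply: ler_sum => i _.
rewrite zsq.
have -> : p i * v i * ((p i)^-1 ^+ 2 * dual_sq i (hat i - y i))
   = (v i / p i) * dual_sq i (hat i - y i) by field; exact: lt0r_neq0.
rewrite ler_piMl ?spd_ge0 //; first exact: spd_invmx.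
by rewrite ler_pdivrMr // mul1r ltW.
Qed.

Lemma expected_step x x' yp ybar :
  prox X T g (x - T *m (\sum_i (A i)^T *m ybar i + grad h x)) x' ->
  (forall i, ybar i = y i + (p i)^-1 *: (y i - yp i)) ->
  (forall i, prox setT (S i) (F i) (y i + S i *m (A i *m x')) (hat i)) ->
  \sum_J law J * (primal_gap x' + \sum_i dual_gap i (next J i)
                  + (lyapunov x' (next J) y + move_sq (next J) y))
  <= lyapunov x y yp + coupling_sq y yp.
Proof.
move=> x'P ybarE hatP.
(* Collects, block by block, all that depends on the next sample; the gap D_i and its multiple 1 /
   p_i - 1 from the Lyapunov function add up to 1 / p_i. *)
pose psi i w := (p i)^-1 * (dual_gap i w + 2^-1 * dual_sq i (w - ys i)
   + 2^-1 * dual_sq i (w - y i) - dot (A i *m (x' - xs)) (w - y i)).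
have sumE J : primal_gap x' + \sum_i dual_gap i (next J i)
                  + (lyapunov x' (next J) y + move_sq (next J) y)
   = primal_gap x' + 2^-1 * primal_sq (x' - xs) + \sum_i psi i (next J i).
  rewrite /lyapunov; set a := \sum_i (_ * _ + _ * _).
  have -> : \sum_i psi i (next J i) = \sum_i dual_gap i (next J i) + a
      - coupling (x' - xs) (next J) y + move_sq (next J) y.
    rewrite /a /coupling /move_sq -sumrN -!big_split /=.
    apply: eq_bigr => i _; rewrite /psi; field; exact: lt0r_neq0.
  ring.
under eq_bigr => J _ do rewrite sumE mulrDr.
have -> : \sum_J (law J * (primal_gap x' + 2^-1 * primal_sq (x' - xs))
                  + law J * \sum_i psi i (next J i))
  = primal_gap x' + 2^-1 * primal_sq (x' - xs) + \sum_i \sum_J law J * psi i (next J i).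
  rewrite big_split -mulr_suml sum_law mul1r; congr (_ + _).
  by rewrite exchange_big; apply: eq_bigr => J _; rewrite mulr_sumr.
(* With probability p_i the factor 1 / p_i cancels and [dual_step] applies. Otherwise w = y_i
   contributes 1 / p_i - 1 times its gap and half square, and the half squares add up to weight 1 /
   (2 p_i). *)
have psiE i : \sum_J law J * psi i (next J i) <=
   (2 * p i)^-1 * dual_sq i (y i - ys i) + ((p i)^-1 - 1) * dual_gap i (y i)
   + dot (A i *m (x' - xs)) (y i - ys i).
  rewrite (sum_law_next i (psi i)) /psi subrr /dual_sq !dot0r -/(dual_sq i _) -/(dual_sq i _).
  have := dual_step (hatP i).
  have -> : dot (A i *m (x' - xs)) (hat i - ys i) =
     dot (A i *m (x' - xs)) (hat i - y i) + dot (A i *m (x' - xs)) (y i - ys i).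
    by rewrite -dotDr addrA subrK.
  rewrite mulVKf ?lt0r_neq0 // -/(dual_sq i _).
  have -> : (2 * p i)^-1 = 2^-1 * (p i)^-1 by rewrite invfM.
  have pV := mulVf (lt0r_neq0 (p_gt0 i)).
  rewrite mulrA mulrBl mul1r mulfV ?lt0r_neq0 //.
  lra.
have : \sum_i \sum_J law J * psi i (next J i) <=
    \sum_i ((2 * p i)^-1 * dual_sq i (y i - ys i) + ((p i)^-1 - 1) * dual_gap i (y i))
    + \sum_i dot (A i *m (x' - xs)) (y i - ys i).
  by rewrite -big_split; exact: ler_sum.
move=> sumle.
have := primal_step x'P.
(* Extrapolation yields the coupling at x' - x*, the Lyapunov function the one at x - x*; only their
   difference, the coupling at x - x', has to be estimated. *)
have := coupling_young (x - x') y yp.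
have -> : dot ((invmx T - L%:M) *m (x - x')) (x - x')
  = dot ((invmx T - L%:M) *m (x' - x)) (x' - x).
  by rewrite -[x - x']opprB mulmxN dotNl dotNr opprK.
have -> : coupling (x - x') y yp
  = coupling (x - xs) y yp - coupling (x' - xs) y yp.
  rewrite /coupling -sumrB; apply: eq_bigr => i _.
  rewrite -mulrBr -dotNl -dotDl -mulmxN -mulmxDr opprB addrA subrK.
  by [].
have -> : \sum_i dot (A i *m (x' - xs)) (ybar i - ys i)
  = \sum_i dot (A i *m (x' - xs)) (y i - ys i) + coupling (x' - xs) y yp.
  rewrite /coupling -big_split; apply: eq_bigr => i _ /=.
  by rewrite ybarE -dotZr -dotDr addrAC.
move: sumle; rewrite /lyapunov.
lra.
Qed.

End Conditional.
End Step.

(** * The saddle gap *)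

Section Saddle.
Context {R : realType} {d m n : nat}.
Variables (X : set 'cV[R]_d) (A : 'I_n -> 'M[R]_(m, d)).
Variables (f : 'I_n -> 'cV[R]_m -> \bar R) (g : 'cV[R]_d -> \bar R).
Variables (h : 'cV[R]_d -> R) (xs : 'cV[R]_d) (ys : 'I_n -> 'cV[R]_m).
Hypotheses (X_convex : convex_set X) (f_proper : forall i, eproper (f i)).
Hypotheses (g_proper : eproper g) (g_convex : econvex g).
Hypothesis h_convex : convex_function setT h.
Hypothesis saddle : saddle_point X (Phi A f g h) xs ys.

Local Notation F := (fun i => conjugate (f i)).
Local Notation pgap := (primal_gap A g h xs ys).
Local Notation dgap := (dual_gap A F xs ys).

Lemma saddle_fin : g xs \is a fin_num /\ forall i, conjugate (f i) (ys i) \is a fin_num.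
Proof.
case: saddle => _ + _ _; rewrite /Phi !fin_numD => /andP[/andP[_ ->] sumfin].
split=> // i; rewrite -fin_numN; move: sumfin.
by rewrite (bigD1 i) //= fin_numD => /andP[]; rewrite fin_numD => /andP[_ ->].
Qed.

Lemma Phi_real x y : g x \is a fin_num ->
  (forall i, conjugate (f i) (y i) \is a fin_num) ->
  Phi A f g h x y =
  (h x + fine (g x) + \sum_i (dot (A i *m x) (y i) - fine (conjugate (f i) (y i))))%:E.
Proof.
move=> gx Fy; rewrite /Phi !EFinD fineK // -sumEFin; congr (_ + _)%E.
by apply: eq_bigr => i _; rewrite EFinB fineK.
Qed.

Lemma Phi_primal x : g x \is a fin_num ->
  Phi A f g h x ys = (Phi A f g h xs ys + (pgap x)%:E)%E.
Proof.
have [gxs Fys] := saddle_fin; move=> gx; rewrite !Phi_real // -EFinD; congr EFin.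
rewrite /primal_gap.
have -> : \sum_i dot (A i *m (x - xs)) (ys i)
  = \sum_i (dot (A i *m x) (ys i) - fine (conjugate (f i) (ys i)))
    - \sum_i (dot (A i *m xs) (ys i) - fine (conjugate (f i) (ys i))).
  rewrite -sumrB; apply: eq_bigr => i _; rewrite mulmxBr dotDl dotNl; ring.
ring.
Qed.

Lemma Phi_dual y : (forall i, conjugate (f i) (y i) \is a fin_num) ->
  Phi A f g h xs y = (Phi A f g h xs ys - (\sum_i dgap i (y i))%:E)%E.
Proof.
have [gxs Fys] := saddle_fin; move=> Fy; rewrite !Phi_real // -EFinB; congr EFin.
have -> : \sum_i dgap i (y i)
  = \sum_i (dot (A i *m xs) (ys i) - fine (conjugate (f i) (ys i)))
    - \sum_i (dot (A i *m xs) (y i) - fine (conjugate (f i) (y i))).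
  rewrite -sumrB; apply: eq_bigr => i _; rewrite /dual_gap dotDr dotNr /=; ring.
ring.
Qed.

Lemma dual_gap_ge0 i y : conjugate (f i) y \is a fin_num -> 0 <= dgap i y.
Proof.
have [gxs Fys] := saddle_fin; move=> Fy.
(* Changing y* in block i alone isolates one term of the saddle inequality. *)
pose y' j := if j == i then y else ys j.
have Fy' j : conjugate (f j) (y' j) \is a fin_num.
  by rewrite /y'; case: eqP => [->|].
case: saddle => _ + /(_ y') + _; rewrite (Phi_dual Fy').
case: (Phi A f g h xs ys) => // r _; rewrite -EFinB lee_fin gerBl.
rewrite (bigD1 i) //= big1 ?addr0 => [|j ji]; first by rewrite /y' eqxx.
by rewrite /y' (negbTE ji) /dual_gap /= subrr subrr dot0r subrr.
Qed.

(** Shaped as the closure condition of [ergodic_avg_jensen]; finiteness is carried along so that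
    [fine] keeps its meaning at the average. *)
Lemma primal_gap_convex u v a b t : 0 < t < 1 ->
  [/\ X u, g u \is a fin_num & pgap u <= a] ->
  [/\ X v, g v \is a fin_num & pgap v <= b] ->
  [/\ X (t *: u + (1 - t) *: v), g (t *: u + (1 - t) *: v) \is a fin_num
    & pgap (t *: u + (1 - t) *: v) <= t * a + (1 - t) * b].
Proof.
move=> t01 [Xu gu ua] [Xv gv vb]; have /andP[t0 t1] := t01.
have gc := g_convex u v t01; have hc := convex_functionE u v h_convex t01.
have gfin : g (t *: u + (1 - t) *: v) \is a fin_num.
  move: gc; rewrite -(fineK gu) -(fineK gv) -!EFinM -EFinD.
  by have := g_proper.1 (t *: u + (1 - t) *: v); case: (g _).
split=> //; first exact: convex_setE.
move: gc; rewrite -(fineK gu) -(fineK gv) -(fineK gfin) -!EFinM -EFinD lee_fin => gc.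
move: ua vb; rewrite /primal_gap.
have -> : \sum_i dot (A i *m (t *: u + (1 - t) *: v - xs)) (ys i)
  = t * \sum_i dot (A i *m (u - xs)) (ys i)
    + (1 - t) * \sum_i dot (A i *m (v - xs)) (ys i).
  rewrite !mulr_sumr -big_split; apply: eq_bigr => i _ /=.
  rewrite !mulmxBr mulmxDr -!scalemxAr !dotDl !dotNl !dotZl; ring.
move: (\sum_i _) (\sum_i _) => su sv ua vb.
have := ler_wpM2l (ltW t0) ua.
have t1' : 0 < 1 - t by rewrite subr_gt0.
have := ler_wpM2l (ltW t1') vb.
lra.
Qed.

Lemma dual_gap_convex i u v a b t : 0 < t < 1 ->
  conjugate (f i) u \is a fin_num /\ dgap i u <= a ->
  conjugate (f i) v \is a fin_num /\ dgap i v <= b ->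
  conjugate (f i) (t *: u + (1 - t) *: v) \is a fin_num /\
  dgap i (t *: u + (1 - t) *: v) <= t * a + (1 - t) * b.
Proof.
move=> t01 [gu ua] [gv vb]; have /andP[t0 t1] := t01.
have gc := conjugate_convex (f_proper i) u v t01.
have gfin : conjugate (f i) (t *: u + (1 - t) *: v) \is a fin_num.
  move: gc; rewrite -(fineK gu) -(fineK gv) -!EFinM -EFinD.
  have := conjugate_gtNy (t *: u + (1 - t) *: v) (f_proper i).
  by case: (conjugate _ _).
split=> //.
move: gc; rewrite -(fineK gu) -(fineK gv) -(fineK gfin) -!EFinM -EFinD lee_fin => gc.
move: ua vb; rewrite /dual_gap !dotDr !dotNr !dotZr => ua vb.
have := ler_wpM2l (ltW t0) ua.
have t1' : 0 < 1 - t by rewrite subr_gt0.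
have := ler_wpM2l (ltW t1') vb.
lra.
Qed.

(** Both values are compared with the finite saddle value, so infinite values are covered and the
    gap can be integrated over all histories. *)
Lemma gap_ge0 x y : X x -> (0 <= Phi A f g h x ys - Phi A f g h xs y)%E.
Proof.
move=> Xx; case: saddle => _ fin /(_ y) le1 /(_ x Xx) le2.
by rewrite -(subee fin); exact: leeB.
Qed.

Lemma ergodic_gap_le (u : nat -> 'cV[R]_d) (v : nat -> 'I_n -> 'cV[R]_m) K :
  (0 < K)%N ->
  (forall k, (0 < k <= K)%N -> X (u k) /\ g (u k) \is a fin_num) ->
  (forall k i, (0 < k <= K)%N -> conjugate (f i) (v k i) \is a fin_num) ->
  (Phi A f g h (ergodic_avg u K) ys
   - Phi A f g h xs (fun i => ergodic_avg (fun k => v k i) K)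
   <= (K%:R^-1 * \sum_(1 <= k < K.+1) (pgap (u k) + \sum_i dgap i (v k i)))%:E)%E.
Proof.
move=> K0 uP vP.
have [_ gu ule] := ergodic_avg_jensen primal_gap_convex (a := pgap \o u) K0
  (fun k kK => And3 (uP k kK).1 (uP k kK).2 (lexx _)).
have vle i := ergodic_avg_jensen (@dual_gap_convex i) (u := v^~ i) (a := fun k => dgap i (v k i)) K0
  (fun k kK => conj (vP k i kK) (lexx _)).
have Fv i := (vle i).1.
rewrite (Phi_dual Fv) Phi_primal //.
case: saddle => _ + _ _; case: (Phi A f g h xs ys) => // r _.
rewrite -!EFinB lee_fin [leRHS]mulrC [in leRHS]big_split /= mulrDl.
have -> : forall r a b : R, r + a - (r - b) = a + b by move=> *; ring.
rewrite lerD //; first by rewrite mulrC.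
rewrite exchange_big mulr_suml; apply: ler_sum => i _.
by rewrite mulrC; have [] := vle i.
Qed.

End Saddle.

(** * Runs of the algorithm *)

(** The primal update at step k precedes the use of sample k, so samples before k already fix
    [x k.+1]; uniqueness of the prox drives the induction. *)
Lemma tos_spdhg_unique (R : realType) (d m n : nat) (X : set 'cV[R]_d)
    (A : 'I_n -> 'M[R]_(m, d)) (f : 'I_n -> 'cV[R]_m -> \bar R)
    (g : 'cV[R]_d -> \bar R) (h : 'cV[R]_d -> R) (p : 'I_n -> R) (theta : R)
    (T : 'M[R]_d) (S : 'I_n -> 'M[R]_m) x0 y0 s s' x x' y y' ybar ybar' :
  convex_set X -> eproper g -> econvex g -> (exists2 z, X z & (g z < +oo)%E) ->
  (forall i, eproper (f i)) -> (forall i, exists z, (conjugate (f i) z < +oo)%E) ->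
  spd T -> (forall i, spd (S i)) ->
  tos_spdhg X A f g h p theta (fun=> T) (fun=> S) x0 y0 s x y ybar ->
  tos_spdhg X A f g h p theta (fun=> T) (fun=> S) x0 y0 s' x' y' ybar' ->
  forall k, (forall j, (j < k)%N -> s j = s' j) ->
  [/\ x k = x' k, y k = y' k, ybar k = ybar' k & x k.+1 = x' k.+1].
Proof.
move=> Xcvx gprop gcvx gdom fprop Fdom Tspd Sspd
  [x0E y0E b0E run] [x0E' y0E' b0E' run'].
have xS k : x k = x' k -> ybar k = ybar' k -> x k.+1 = x' k.+1.
  move=> xk bk; have [+ _ _ _] := run k; have [+ _ _ _] := run' k.
  by rewrite xk bk => /[swap]; apply: prox_unique => //; exact: gprop.1.
elim=> [|k IH] ss.
  have xk : x 0%N = x' 0%N by rewrite x0E x0E'.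
  have bk : ybar 0%N = ybar' 0%N by rewrite b0E b0E'.
  by split=> //; [rewrite y0E y0E'|exact: xS].
have [xk yk bk xk1] : [/\ x k = x' k, y k = y' k, ybar k = ybar' k & x k.+1 = x' k.+1].
  by apply: IH => j jk; apply: ss; rewrite ltnW.
have [_ upd keep barE] := run k; have [_ upd' keep' barE'] := run' k.
have yk1 : y k.+1 = y' k.+1.
  apply: funext => i; have sk := ss k (ltnSn k).
  have [iS|iS] := boolP (i \in s k); last first.
    by rewrite keep // keep' -?sk // yk.
  have := upd i iS; have := upd' i; rewrite -sk -yk -xk1 => /(_ iS) /[swap].
  have [z Fz] := Fdom i.
  apply: (prox_unique (@convex_set_setT _ _) (fun w => conjugate_gtNy w (fprop i))
            (conjugate_convex (fprop i)) _ (Sspd i)).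
  by exists z.
have bk1 : ybar k.+1 = ybar' k.+1.
  by apply: funext => i; rewrite barE barE' yk1 yk.
by split=> //; exact: xS.
Qed.

Section Run.
Context {R : realType} {d m n : nat}.
Variables (X : set 'cV[R]_d) (A : 'I_n -> 'M[R]_(m, d)).
Variables (f : 'I_n -> 'cV[R]_m -> \bar R) (g : 'cV[R]_d -> \bar R).
Variables (h : 'cV[R]_d -> R) (L : R).
Hypotheses (X_convex : convex_set X) (f_proper : forall i, eproper (f i)).
Hypotheses (g_proper : eproper g) (g_convex : econvex g).
Hypotheses (h_convex : convex_function setT h).
Hypotheses (h_diff : forall x, differentiable h x) (L_ge0 : 0 <= L).
Hypothesis h_lip : forall x x', norm2 (grad h x - grad h x') <= L * norm2 (x - x').
Variables (xs : 'cV[R]_d) (ys : 'I_n -> 'cV[R]_m).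
Hypothesis saddle : saddle_point X (Phi A f g h) xs ys.
Context {dd : measure_display} {Omega : measurableType dd}.
Variables (P : probability Omega R) (law : {set 'I_n} -> R).
Variable Sk : nat -> Omega -> {set 'I_n}.
Hypotheses (sampling : iid_sampling P law Sk).
Local Notation p := (inclusion_prob law).
Hypothesis p_gt0 : forall i, 0 < p i.
Variables (T : 'M[R]_d) (S : 'I_n -> 'M[R]_m).
Hypotheses (T_spd : spd T) (S_spd : forall i, spd (S i)).
Variables (Shalf : 'I_n -> 'M[R]_m) (TLhalf : 'M[R]_d) (v : 'I_n -> R).
Hypotheses (Shalf_sqrt : forall i, is_sqrtmx (S i) (Shalf i)).
Hypotheses (TLhalf_sqrt : is_sqrtmx (invmx T - L%:M) TLhalf).
Hypotheses (ESO : eso law (eso_block A Shalf TLhalf) v) (v_lt_p : forall i, v i < p i).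
Variables (x0 : 'cV[R]_d) (y0 : 'I_n -> 'cV[R]_m).
Hypothesis y0_dom : forall i, p i < 1 -> (conjugate (f i) (y0 i) < +oo)%E.
Variables (x : nat -> Omega -> 'cV[R]_d) (y ybar : nat -> Omega -> 'I_n -> 'cV[R]_m).
Hypothesis iterates : forall w,
  tos_spdhg X A f g h p 1 (fun=> T) (fun=> S) x0 y0
    (Sk ^~ w) (x ^~ w) (y ^~ w) (ybar ^~ w).

Local Notation F := (fun i => conjugate (f i)).
Local Notation rep := (history_rep Sk).

Lemma saddle_dual_dom i : exists2 z, [set: 'cV[R]_m] z & (F i z < +oo)%E.
Proof. by have [_ Fys] := saddle_fin saddle; exists (ys i); rewrite // ltey_eq Fys. Qed.

Lemma saddle_primal_dom : exists2 z, X z & (g z < +oo)%E.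
Proof.
have [gxs _] := saddle_fin saddle.
by exists xs; [case: saddle | rewrite ltey_eq gxs].
Qed.

Lemma iterates_same k w w' : (forall j, (j < k)%N -> Sk j w = Sk j w') ->
  [/\ x k w = x k w', y k w = y k w' & x k.+1 w = x k.+1 w'].
Proof.
move=> ww'.
have [] // := tos_spdhg_unique X_convex g_proper g_convex saddle_primal_dom
  f_proper _ T_spd S_spd (iterates w) (iterates w') ww'.
by move=> i; have [z _ Fz] := saddle_dual_dom i; exists z.
Qed.

Lemma iterates_primal k w : X (x k.+1 w) /\ g (x k.+1 w) \is a fin_num.
Proof.
have [_ _ _ /(_ k)[xP _ _ _]] := iterates w; split; first by case: xP.
by apply: prox_fin xP; [exact: g_proper.1|exact: saddle_primal_dom].
Qed.

(** A block is either a prox output, hence finite, or was skipped by a sample of positive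
    probability; then p_i < 1 and the claim descends to the previous step, at worst to y0. *)
Lemma iterates_dual k w : (forall j, (j < k)%N -> 0 < law (Sk j w)) ->
  forall i, (0 < k)%N || (p i < 1) -> F i (y k w i) \is a fin_num.
Proof.
have [_ y0E _ run] := iterates w.
elim: k => [_ i|k IH Skpos i _].
  rewrite /= => pi1; rewrite y0E fin_numElt y0_dom // andbT.
  exact: conjugate_gtNy.
have [_ upd keep _] := run k.
have [iS|iS] := boolP (i \in Sk k w).
  apply: prox_fin (upd i iS); last exact: saddle_dual_dom.
  by move=> z; exact: conjugate_gtNy.
rewrite keep //; apply: IH => [j jk|]; first by apply: Skpos; rewrite ltnW.
apply/orP; right.
by apply: (inclusion_prob_lt1 sampling) iS; exact: Skpos.
Qed.

Definition path_gap k w : R :=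
  primal_gap A g h xs ys (x k w) + \sum_i dual_gap A F xs ys i (y k w i).

Definition path_total K w : R := \sum_(1 <= k < K.+1) path_gap k w.

(* At [k = 0] the predecessor [y k.-1] is [y 0] itself, in accordance with
   [ybar 0 = y 0]. *)
Definition path_potential k w : R :=
  lyapunov A F xs ys law T S (x k w) (y k w) (y k.-1 w)
  + coupling_sq A law Shalf TLhalf (y k w) (y k.-1 w).

Lemma path_total_same K w w' :
  (forall j, (j < K)%N -> Sk j w = Sk j w') -> path_total K w = path_total K w'.
Proof.
move=> ww'; apply: eq_big_nat => k /andP[k0 kK].
have [j jk|xE yE _] := iterates_same (k := k) (w := w) (w' := w').
  by apply: ww'; exact: leq_trans jk _.
by rewrite /path_gap xE yE.
Qed.

(** Representatives of the extended histories share the past of w, so the conditional inequalities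
    apply with [next J] read off from them. *)
Lemma potential_step k (t : k.-tuple {set 'I_n}) : 0 < weight law t ->
  \sum_J law J * (path_gap k.+1 (rep (rcons_tuple t J))
                  + path_potential k.+1 (rep (rcons_tuple t J)))
  <= path_potential k (rep t).
Proof.
move=> t0; set w := rep t.
have law0 := law_ge0 sampling; have law1 := sum_law sampling.
have [gxs Fys] := saddle_fin saddle.
have F_gtNy i z : (-oo < F i z)%E by exact: conjugate_gtNy.
have F_convex i : econvex (F i) by exact: conjugate_convex.
pose next J := y k.+1 (rep (rcons_tuple t J)).
have repJ J := history_rep_rcons (J := J) sampling t0.
have sameJ J : 0 < law J ->
    [/\ x k (rep (rcons_tuple t J)) = x k w, y k (rep (rcons_tuple t J)) = y k w
      & x k.+1 (rep (rcons_tuple t J)) = x k.+1 w].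
  by move=> /repJ[tJ _]; apply/iterates_same/histP; rewrite tJ (history_repP sampling).
(* A positive-probability sample containing [i] realizes the full dual update
   of block [i], so no existence theorem for the prox of the conjugate is
   needed. *)
have pick i : exists J, 0 < law J /\ i \in J.
  apply: contrapT => noJ; have := p_gt0 i; rewrite /inclusion_prob big1 ?ltxx //.
  move=> J iJ; apply/eqP; rewrite eq_le law0 andbT leNgt; apply/negP => J0.
  by apply: noJ; exists J.
pose Jof i := projT1 (cid (pick i)).
have [JofP iJof] : (forall i, 0 < law (Jof i)) /\ forall i, i \in Jof i.
  by split=> i; rewrite /Jof; case: cid => ? [].
pose hat i := next (Jof i) i.
have nextP J i : 0 < law J -> i \in J ->
    prox setT (S i) (F i) (y k w i + S i *m (A i *m x k.+1 w)) (next J i).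
  move=> J0 iJ; have [_ <- <-] := sameJ J J0; have [_ SJ] := repJ J J0.
  have [_ _ _ /(_ k)[_ upd _ _]] := iterates (rep (rcons_tuple t J)).
  by apply: upd; rewrite /= SJ.
have hatP i := nextP _ i (JofP i) (iJof i).
have next_hat J i : 0 < law J -> next J i = if i \in J then hat i else y k w i.
  move=> J0; case: ifPn => iJ.
    exact: (prox_unique (@convex_set_setT _ _) (F_gtNy i) (F_convex i)
              (saddle_dual_dom i) (S_spd i) (nextP J i J0 iJ) (hatP i)).
  have [_ SJ] := repJ J J0; have [_ <- _] := sameJ J J0.
  have [_ _ _ /(_ k)[_ _ keep _]] := iterates (rep (rcons_tuple t J)).
  by apply: keep; rewrite /= SJ.
have [_ yw0 bw0 run] := iterates w.
have barE i : ybar k w i = y k w i + (p i)^-1 *: (y k w i - y k.-1 w i).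
  case: (k) => [|k'] /=; first by rewrite bw0 yw0 subrr scaler0 addr0.
  by have [_ _ _ ->] := run k'; rewrite scale1r.
have [x'P _ _ _] := run k; have Xxs : X xs by case: saddle.
apply: le_trans (expected_step X_convex F_gtNy F_convex g_proper.1 g_convex
  h_convex h_diff L_ge0 h_lip Xxs gxs Fys law0 law1 p_gt0 T_spd S_spd Shalf_sqrt
  TLhalf_sqrt next_hat x'P barE hatP).
(* The [move_sq] gained in [expected_step] pays for [coupling_sq] in the next potential. *)
have leM := eso_step law0 law1 p_gt0 S_spd Shalf_sqrt next_hat ESO v_lt_p.
under [leRHS]eq_bigr => J _ do rewrite addrA mulrDr.
rewrite [leRHS]big_split /=; apply: le_trans (lerD (lexx _) leM).
rewrite -big_split /=; apply: ler_sum => J _.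
have := law0 J; rewrite le_eqVlt => /orP[/eqP <-|J0]; first by rewrite !mul0r addr0.
have [_ yJ xJ] := sameJ J J0.
by rewrite /path_gap /path_potential /= xJ yJ -mulrDr -[in leRHS]addrA.
Qed.

(** Telescoping through the tower property; the gaps up to K are unchanged by sample K and pass
    through the inner average. *)
Lemma expect_total_potential K :
  expect law (fun t : K.-tuple {set 'I_n} =>
    path_total K (rep t) + path_potential K (rep t))
  <= expect law (fun t : 0.-tuple {set 'I_n} => path_potential 0 (rep t)).
Proof.
have law0 := law_ge0 sampling; have law1 := sum_law sampling.
elim: K => [|K IH].
  by apply: (expect_le sampling) => t _; rewrite /path_total big_geq // add0r.
apply: le_trans IH; rewrite (expectS law); apply: (expect_le sampling) => t t0.
apply: le_trans (lerD (lexx _) (potential_step t0)).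
rewrite -[path_total K _ in leRHS]mul1r -law1 mulr_suml -big_split /=.
apply: ler_sum => J _.
have := law0 J; rewrite le_eqVlt => /orP[/eqP <-|J0]; first by rewrite !mul0r addr0.
rewrite -mulrDr [in leRHS]addrA ler_pM2l // lerD2r.
rewrite /path_total (big_nat_recr K.+1) //= lerD2r.
rewrite -/(path_total _ _) (@path_total_same _ _ (rep t)) //.
apply/histP; rewrite (history_repP sampling t0).
exact: (history_rep_rcons sampling t0 J0).1.
Qed.

Lemma path_potential_ge0 K (t : K.-tuple {set 'I_n}) :
  (0 < K)%N -> 0 < weight law t -> 0 <= path_potential K (rep t).
Proof.
(* From step 1 on, every conjugate value on a possible path is finite, so each D_i is
   nonnegative. *)
move=> K0 t0; apply: (lyapunov_coupling_ge0 L_ge0) => // i.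
apply: mulr_ge0; first by rewrite subr_ge0 invf_ge1 // (inclusion_prob_le1 sampling).
apply: (dual_gap_ge0 saddle); apply: iterates_dual; rewrite ?K0 //.
exact: (weight_gt0_law sampling t0).
Qed.

Lemma expect_total_le K : (0 < K)%N ->
  expect law (fun t : K.-tuple {set 'I_n} => path_total K (rep t))
  <= expect law (fun t : 0.-tuple {set 'I_n} => path_potential 0 (rep t)).
Proof.
move=> K0; apply: le_trans (expect_total_potential K).
by apply: (expect_le sampling) => t t0; rewrite lerDl path_potential_ge0.
Qed.

Definition ergodic_gap K w : \bar R :=
  (Phi A f g h (ergodic_avg (x ^~ w) K) ys
   - Phi A f g h xs (fun i => ergodic_avg (fun k => y k w i) K))%E.

Lemma ergodic_gap_ge0 K w : (0 < K)%N -> (0 <= ergodic_gap K w)%E.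
Proof.
move=> K0; apply: (gap_ge0 saddle).
apply: (@ergodic_avg_jensen _ _ (fun u _ => X u) (x ^~ w) (fun=> 0) _ K K0).
  by move=> u u' _ _ t t01; exact: convex_setE.
by move=> [|k] // _; case: (iterates_primal k w).
Qed.

(** The history of w is realized by w itself, so its representative has the same first K samples and
    hence the same iterates up to K. *)
Lemma ergodic_gap_hist K w : ergodic_gap K w = ergodic_gap K (rep (hist Sk K w)).
Proof.
set w' := rep _; have ww' : hist Sk K w = hist Sk K w'.
  rewrite /w' /history_rep.
  by have /(xgetPex point) : exists u, [set u | hist Sk K u = hist Sk K w] u by exists w.
have same k : (k <= K)%N -> x k w = x k w' /\ y k w = y k w'.
  move=> kK; have [j jk|-> -> //] := iterates_same (k := k) (w := w) (w' := w').
  by apply: (histP ww'); exact: leq_trans kK.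
have xE : ergodic_avg (x ^~ w) K = ergodic_avg (x ^~ w') K.
  by congr (_ *: _); apply: eq_big_nat => k /andP[_ /same[]].
have yE : (fun i => ergodic_avg (fun k => y k w i) K)
    = (fun i => ergodic_avg (fun k => y k w' i) K).
  apply: funext => i; congr (_ *: _).
  by apply: eq_big_nat => k /andP[_ /same[_ ->]].
by rewrite /ergodic_gap xE yE.
Qed.

Lemma expected_ergodic_gap_le K : (0 < K)%N ->
  (\int[P]_w ergodic_gap K w <=
   (expect law (fun t : 0.-tuple {set 'I_n} => path_potential 0 (rep t)) / K%:R)%:E)%E.
Proof.
move=> K0; under eq_integral => w _ do rewrite ergodic_gap_hist.
rewrite (integral_hist sampling (F := fun t => ergodic_gap K (rep t))); last first.
  by move=> t; exact: ergodic_gap_ge0.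
apply: (@le_trans _ _ (\sum_(t : K.-tuple {set 'I_n})
    (weight law t * (K%:R^-1 * path_total K (rep t)))%:E)%E).
  apply: lee_sum => t _.
  (* On histories of weight zero the gap may be infinite, but its product with 0 is 0. *)
  have := weight_ge0 sampling t; rewrite le_eqVlt => /orP[/eqP <-|t0].
    by rewrite mule0 mul0r.
  rewrite muleC EFinM lee_pmul2l ?lte_fin //.
  apply: (ergodic_gap_le X_convex f_proper g_proper g_convex h_convex saddle K0).
    by move=> [|k] // _; exact: iterates_primal.
  move=> k i /andP[k0 kK]; apply: iterates_dual; rewrite ?k0 // => j jk.
  by apply: (weight_gt0_law sampling t0); exact: leq_trans kK.
rewrite sumEFin lee_fin; under eq_bigr do rewrite mulrCA.
rewrite -mulr_sumr [leRHS]mulrC ler_pM2l ?invr_gt0 ?ltr0n //.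
exact: expect_total_le.
Qed.

End Run.

Theorem theorem1 (R : realType) (d m n : nat)
  (X : set 'cV[R]_d) (A : 'I_n -> 'M[R]_(m, d))
  (f : 'I_n -> 'cV[R]_m -> \bar R) (g : 'cV[R]_d -> \bar R)
  (h : 'cV[R]_d -> R) (L : R)
  (X_nonempty : X !=set0) (X_closed : closed X) (X_convex : convex_set X)
  (f_proper : forall i, eproper (f i)) (f_convex : forall i, econvex (f i))
  (f_lsc : forall i, lower_semicontinuous (f i))
  (g_proper : eproper g) (g_convex : econvex g) (g_lsc : lower_semicontinuous g)
  (g_finite : exists2 x, X x & g x \is a fin_num)
  (h_convex : convex_function setT h)
  (h_diff : forall x, differentiable h x)
  (L_ge0 : 0 <= L)
  (h_lip : forall x x', norm2 (grad h x - grad h x') <= L * norm2 (x - x'))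
  (xstar : 'cV[R]_d) (ystar : 'I_n -> 'cV[R]_m)
  (saddle : saddle_point X (Phi A f g h) xstar ystar)
  (* sampling *)
  (dd : measure_display) (Omega : measurableType dd) (P : probability Omega R)
  (law : {set 'I_n} -> R) (Sk : nat -> Omega -> {set 'I_n})
  (sampling : iid_sampling P law Sk)
  (p_gt0 : forall i, 0 < inclusion_prob law i)
  (* step sizes *)
  (T : 'M[R]_d) (S : 'I_n -> 'M[R]_m)
  (T_spd : spd T) (S_spd : forall i, spd (S i))
  (TL_spd : spd (invmx T - L%:M))
  (Shalf : 'I_n -> 'M[R]_m) (Shalf_sqrt : forall i, is_sqrtmx (S i) (Shalf i))
  (TLhalf : 'M[R]_d) (TLhalf_sqrt : is_sqrtmx (invmx T - L%:M) TLhalf)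
  (ESO : exists v : 'I_n -> R,
     eso law (fun i => Shalf i *m A i *m invmx TLhalf) v /\
     forall i, v i < inclusion_prob law i)
  (* iterates *)
  (x0 : 'cV[R]_d) (y0 : 'I_n -> 'cV[R]_m)
  (y0_dom : forall i, inclusion_prob law i < 1 ->
     (conjugate (f i) (y0 i) < +oo)%E)
  (x : nat -> Omega -> 'cV[R]_d) (y ybar : nat -> Omega -> 'I_n -> 'cV[R]_m)
  (iterates : forall w,
     tos_spdhg X A f g h (inclusion_prob law) 1 (fun=> T) (fun=> S) x0 y0
       (Sk ^~ w) (x ^~ w) (y ^~ w) (ybar ^~ w)) :
  exists C : R, forall K : nat, (0 < K)%N ->
    (\int[P]_w
       (Phi A f g h (ergodic_avg (x ^~ w) K) ystar
        - Phi A f g h xstar (fun i => ergodic_avg (fun k => y k w i) K))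
     <= (C / K%:R)%:E)%E.
Proof.
have [v [eso_v v_lt_p]] := ESO.
(* C is the expected initial potential. At step 0 the previous dual point is y0 itself, so both
   coupling terms vanish and only the distances to the saddle point and the weighted gaps D_i(y0_i)
   remain. *)
eexists => K K0.
exact: (expected_ergodic_gap_le X_convex f_proper g_proper g_convex h_convex h_diff
  L_ge0 h_lip saddle sampling p_gt0 T_spd S_spd Shalf_sqrt TLhalf_sqrt eso_v v_lt_p
  y0_dom iterates K0).
Qed.
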